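(* Let $P$ be a poset, let $A\subset P^*$, and let $\sigma$ be the map from $P$ to $\mathrm{C}_1\mathrm{O}_2(A,\mathbf{C}_{1,A},\mathbf{C}_{2,A})$ given by $\sigma(p)=\mathcal{UP}_A(p)$. Then: (1) $\sigma$ is isotone; (2) if $A$ is full, then $\sigma$ is injective; (3) if $A$ is separating, then $\sigma$ is surjective.
   Context: For a poset $P$, $P^*$ denotes the set of all isotone (order-preserving) maps from $P$ to $\mathbf 2=\{0,1\}$ with $0<1$. A closure on a set $M$ is a map $\mathbf C:\exp(M)\to\exp(M)$ on subsets of $M$ with $X\subset\mathbf C(X)$, $\mathbf C(\mathbf C(X))=\mathbf C(X)$, and $X\subset Y\Rightarrow\mathbf C(X)\subset\mathbf C(Y)$. A set $X$ is closed if $X=\mathbf C(X)$ and open if $M\setminus X$ is closed. For $\mathcal K\subset\exp(M)$, $\mathrm{clos}(\mathcal K)$ is the closure whose closed sets are exactly the intersections of subfamilies of $\mathcal K$ (the empty intersection being $M$). For two closures $\mathbf C_1,\mathbf C_2$ on $M$, $\mathrm{C}_1\mathrm{O}_2(M,\mathbf C_1,\mathbf C_2)$ is the collection of all subsets of $M$ that are both $\mathbf C_1$-closed and $\mathbf C_2$-open, ordered by inclusion. For $A\subset P^*$ and $p\in P$ put $\mathcal{UP}_A(p)=\{x\in A: x(p)=1\}$ and $\mathcal{LO}_A(p)=\{x\in A: x(p)=0\}$, and let $\mathbf C_{1,A}=\mathrm{clos}\{\mathcal{UP}_A(p)\}_{p\in P}$, $\mathbf C_{2,A}=\mathrm{clos}\{\mathcal{LO}_A(p)\}_{p\in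 P}$ be closures on $A$. (Each $\mathcal{UP}_A(p)$ belongs to $\mathrm{C}_1\mathrm{O}_2(A,\mathbf C_{1,A},\mathbf C_{2,A})$.) An $A$-ideal (ideal with respect to $A$) is a subset of $P$ of the form $\bigcap_{x\in B}x^{-1}(0)$ with $B\subset A$; an $A$-filter is a subset of the form $\bigcap_{x\in B}x^{-1}(1)$ with $B\subset A$. Here $B=\emptyset$ is allowed and gives $P$. $A$ is full if for all $p,q\in P$ with $p\not\leq q$ there is $x\in A$ with $x(p)=1$, $x(q)=0$. $A$ is separating if for any disjoint $A$-ideal $I$ and $A$-filter $F$ there is $x\in A$ with $x|_I=0$ and $x|_F=1$. *)

(* Defs.v *)
From HB Require Import structures.
From mathcomp Require Import all_boot all_order.
From mathcomp Require Import boolp classical_sets functions.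

Set Implicit Arguments.
Unset Strict Implicit.
Unset Printing Implicit Defensive.

Import Order.TTheory.
Local Open Scope order_scope.
Local Open Scope classical_set_scope.

Record closure_on (M : Type) := ClosureOn {
  closure_map :> set M -> set M;
  closure_ext : forall X, X `<=` closure_map X;
  closure_idem : forall X, closure_map (closure_map X) = closure_map X;
  closure_mono : forall X Y, X `<=` Y -> closure_map X `<=` closure_map Y
}.

Definition cl_closed M (C : closure_on M) (X : set M) : Prop := X = C X.
Definition cl_open M (C : closure_on M) (X : set M) : Prop := cl_closed C (~` X).

Section Clos.
Variables (M : Type) (K : set (set M)).

Let smallest_idem X : smallest K (smallest K X) = smallest K X.
Proof.
apply/seteqP; split; last exact: sub_gen_smallest.
move=> x xX Y [KY XY]; apply: xX; split => //.
exact: smallest_sub.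
Qed.

Let smallest_mono X Y : X `<=` Y -> smallest K X `<=` smallest K Y.
Proof. by move=> XY x xX Z [KZ YZ]; apply: xX; split => // y /XY /YZ. Qed.

(* [smallest K X] is the intersection of all members of K containing X; it
   need not itself belong to K. *)
Definition clos : closure_on M :=
  ClosureOn (@sub_gen_smallest M K) smallest_idem smallest_mono.

Lemma clos_closedP X :
  cl_closed clos X <-> exists2 L, L `<=` K & X = \bigcap_(Y in L) Y.
Proof.
split=> [XE|[L LK ->]].
  by exists [set Y | K Y /\ X `<=` Y] => // Y [].
apply/seteqP; split; first exact: sub_gen_smallest.
move=> x xL Y LY; apply: xL; split; first exact: LK.
by move=> y; apply.
Qed.

End Clos.

(* The first-closed, second-open subsets of M, ordered by inclusion through the
   order of [set M]. *)
Record C1O2 (M : Type) (C1 C2 : closure_on M) := MkC1O2 {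
  C1O2_set :> set M;
  C1O2P : `[< cl_closed C1 C1O2_set /\ cl_open C2 C1O2_set >]
}.

HB.instance Definition _ M (C1 C2 : closure_on M) :=
  [isSub for @C1O2_set M C1 C2].
HB.instance Definition _ M (C1 C2 : closure_on M) :=
  [Choice of C1O2 C1 C2 by <:].
HB.instance Definition _ M (C1 C2 : closure_on M) :=
  [SubChoice_isSubPOrder of C1O2 C1 C2 by <: with set_display].

Lemma le_C1O2E M (C1 C2 : closure_on M) (X Y : C1O2 C1 C2) :
  (X <= Y) = `[< C1O2_set X `<=` C1O2_set Y >].
Proof. by []. Qed.

(* P^* is [{omorphism P -> bool}], with [false < true]. *)
Section Representation.
Variables (d : Order.disp_t) (P : porderType d) (A : set {omorphism P -> bool}).

(* Subsets of A are sets over the subtype [set_type A] of its elements. *)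
Definition UP (p : P) : set (set_type A) := [set x : A | val x p = true].
Definition LO (p : P) : set (set_type A) := [set x : A | val x p = false].

Definition closure1 : closure_on (set_type A) := clos (range UP).
Definition closure2 : closure_on (set_type A) := clos (range LO).

Lemma UP_C1O2 p : `[< cl_closed closure1 (UP p) /\ cl_open closure2 (UP p) >].
Proof.
apply/asboolP; split.
  apply/clos_closedP; exists [set UP p]; last by rewrite bigcap_set1.
  by move=> _ ->; exists p.
apply/clos_closedP; exists [set LO p]; first by move=> _ ->; exists p.
rewrite bigcap_set1; apply/seteqP; rewrite /UP /LO.
by split=> x /=; case: (val x p).
Qed.

Definition sigma (p : P) : C1O2 closure1 closure2 := MkC1O2 (UP_C1O2 p).

Definition ideal_wrt (I : set P) : Prop :=
  exists2 B, B `<=` A & I = \bigcap_(x in B) (x @^-1` [set false]).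

Definition filter_wrt (F : set P) : Prop :=
  exists2 B, B `<=` A & F = \bigcap_(x in B) (x @^-1` [set true]).

Definition full : Prop :=
  forall p q : P, ~~ (p <= q) -> exists2 x, A x & x p = true /\ x q = false.

Definition separating : Prop :=
  forall I F : set P, ideal_wrt I -> filter_wrt F -> I `&` F = set0 ->
  exists2 x, A x & (forall p, I p -> x p = false) /\ (forall p, F p -> x p = true).

End Representation.

Arguments UP {d P} A p.
Arguments LO {d P} A p.

(* Main.v *)
Require Import Defs.
From HB Require Import structures.
From mathcomp Require Import all_boot all_order.
From mathcomp Require Import boolp classical_sets functions.

Import Order.TTheory.
Local Open Scope order_scope.
Local Open Scope classical_set_scope.

Section Representation.
Context {d : Order.disp_t} {P : porderType d} (A : set {omorphism P -> bool}).

Lemma UP_homo (p q : P) : p <= q -> UP A p `<=` UP A q.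
Proof.
move=> pq x xp.
have := omorph_le (val x) pq.
by rewrite /UP /= xp; case: (val x q).
Qed.

Lemma sigma_homo : {homo sigma A : p q / p <= q}.
Proof. by move=> p q /UP_homo pq; rewrite le_C1O2E; apply/asboolP. Qed.

(** Converse of [UP_homo]: if [p <= q] failed, fullness would give a point of [A] lying in [UP A p]
    but not in [UP A q]. Injectivity of [sigma] then follows by antisymmetry. *)
Lemma full_UP_le (p q : P) : full A -> UP A p `<=` UP A q -> p <= q.
Proof.
move=> fullA pq; apply: contrapT => /negP /fullA[x Ax [xp xq]].
have /(_ xp) := pq (SigSub (mem_set Ax)).
by rewrite /UP /= xq.
Qed.

Lemma full_sigma_inj : full A -> injective (sigma A).
Proof.
move=> fullA p q /(congr1 (@C1O2_set _ _ _)) /= pq.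
by apply/le_anti/andP; split; apply: full_UP_le => //; rewrite pq.
Qed.

(* If no [p] satisfied [X = UP A p], the [A]-filter of the [p] with
   [X `<=` UP A p] and the [A]-ideal of the [p] with [~` X `<=` LO A p] would be
   disjoint, and a point of [A] separating them would lie both in [X], which is
   closed for [closure1], and in [~` X], which is closed for [closure2]. *)
Lemma separating_UP {X : set (set_type A)} : separating A ->
  cl_closed (closure1 A) X -> cl_open (closure2 A) X -> exists p, UP A p = X.
Proof.
move=> sepA clX opX.
(* [X] lives over the subtype of [A], so its image under [val] serves as the family [B] defining an
   [A]-filter. *)
pose F := \bigcap_(x in val @` X) (x @^-1` [set true]) : set P.
pose I := \bigcap_(x in val @` (~` X)) (x @^-1` [set false]) : set P.
have sub_A (B : set (set_type A)) : val @` B `<=` A.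
  by move=> _ [x _ <-]; exact: set_valP.
have [p [Ip Fp]] : I `&` F !=set0.
  apply/set0P/eqP => IF0.
  have [x Ax [xI xF]] : exists2 x, A x &
      (forall p, I p -> x p = false) /\ (forall p, F p -> x p = true).
    by apply: sepA IF0; [exists (val @` (~` X)) | exists (val @` X)].
  have xX : X (SigSub (mem_set Ax)).
    (* Replacing [X] by its closure, it suffices that [x] lies in every [UP A p] containing [X];
       each such [p] is in [F]. *)
    rewrite clX /= => _ [[p _ <-] Xp]; apply: xF => _ [y Xy <-]; exact: Xp.
  suff : (~` X) (SigSub (mem_set Ax)) by [].
  rewrite opX /= => _ [[p _ <-] Xp]; apply: xI => _ [y Xy <-]; exact: Xp.
(* [Fp] gives the inclusion of [X] in [UP A p], and [Ip] the reverse one. *)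
exists p; apply/seteqP; split=> x; last by move=> Xx; apply: Fp; exists x.
move=> xp; apply: contrapT => nXx.
have : val x p = false by apply: Ip; exists x.
by rewrite xp.
Qed.

Lemma separating_sigma_surj : separating A ->
  set_surj [set: P] [set: C1O2 (closure1 A) (closure2 A)] (sigma A).
Proof.
move=> sepA X _; have /asboolP[clX opX] := C1O2P X.
have [p pX] := separating_UP sepA clX opX.
(* Elements of [C1O2] with the same underlying set are equal, the attached condition being a
   boolean. *)
by exists p => //; apply: val_inj.
Qed.

End Representation.

Theorem theorem2 (d : Order.disp_t) (P : porderType d)
    (A : set {omorphism P -> bool}) :
  [/\ {homo sigma A : p q / p <= q},
      full A -> injective (sigma A) &
      separating A -> set_surj [set: P] [set: C1O2 (closure1 A) (closure2 A)] (sigma A)].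
Proof.
split; [exact: sigma_homo | exact: full_sigma_inj | exact: separating_sigma_surj].
Qed.
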